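(* For solutions $x$ of the equation $$m\,\ddot x^\mu=e\,F^\mu{}_\nu\,\dot x^\nu-\tfrac23\,e^2\,\eta_{\rho\sigma}\ddot x^\rho\ddot x^\sigma\,\dot x^\mu$$ the following asymptotic condition holds: $$\lim_{\tau\to\infty}F_L(\tau)=0\ \Longrightarrow\ \lim_{\tau\to\infty}a^2(\tau)=0,$$ where $a^2=\eta(\ddot x,\ddot x)$ and $F_L$ is the magnitude of the Lorentz force.
   Context: $M$ is four-dimensional Minkowski spacetime with metric $\eta$ of signature $(-1,1,1,1)$, in a global normal coordinate system ($\eta$ constant diagonal), units with $c=1$. $m>0$ and $e\neq 0$ are the mass and charge. $A_{max}>0$ is a constant (maximal acceleration). World-lines are smooth curves (here defined for all large $\tau$) parameterized by the proper time $\tau$ of the metric of maximal acceleration $g=(1-\epsilon)\eta$, $\epsilon(\tau)=\eta(\ddot x,\ddot x)/A_{max}^2$, so that $g(\dot x,\dot x)=-1$; dots are derivatives with respect to $\tau$. Accelerations satisfy $0\le\eta(\ddot x,\ddot x)<A^2_{max}$ (the regime considered is $\epsilon\ll1$). $F=F_{\mu\nu}dx^\mu\wedge dx^\nu$ is a smooth electromagnetic 2-form (antisymmetric components), $F^\mu{}_\nu=\eta^{\mu\rho}F_{\rho\nu}$, and $F_L^2=e^2\,\eta_{\mu\nu}F^\mu{}_\rho\dot x^\rho F^\nu{}_\lambda\dot x^\lambda$. *)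

(* Defs.v *)
From HB Require Import structures.
From mathcomp Require Import all_boot all_order all_algebra.
From mathcomp Require Import all_classical all_reals all_analysis.

Set Implicit Arguments.
Unset Strict Implicit.
Unset Printing Implicit Defensive.

Import Order.TTheory GRing.Theory Num.Theory.
Import numFieldNormedType.Exports.

Local Open Scope classical_set_scope.
Local Open Scope ring_scope.

(* C^oo on an open set U of a finite-dimensional space: every iterated
   directional derivative is differentiable (hence continuous) on U. *)
Definition smooth_on (R : realType) (V W : normedModType R)
    (U : set V) (f : V -> W) : Prop :=
  forall (vs : seq V) (p : V), U p ->
    differentiable (foldr (fun v h => 'D_v h) f vs) p.

Section Minkowski.
Variable R : realType.

(* Both points and tangent vectors of Minkowski spacetime are elements of
   'cV[R]_4: their components in the global normal coordinates. *)

Definition eta : 'M[R]_4 :=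
  diag_mx (\row_(i < 4) (if i == ord0 then - 1 else 1)).

Definition mink (u v : 'cV[R]_4) : R :=
  \sum_(mu < 4) \sum_(nu < 4) eta mu nu * u mu ord0 * v nu ord0.

Definition velocity (x : R -> 'cV[R]_4) : R -> 'cV[R]_4 := (x^`())%classic.

Definition acceleration (x : R -> 'cV[R]_4) : R -> 'cV[R]_4 :=
  ((velocity x)^`())%classic.

Definition accel2 (x : R -> 'cV[R]_4) (t : R) : R :=
  mink (acceleration x t) (acceleration x t).

Definition epsilon (Amax : R) (x : R -> 'cV[R]_4) (t : R) : R :=
  accel2 x t / Amax ^+ 2.

(* The metric of maximal acceleration along the world-line x. *)
Definition gmax (Amax : R) (x : R -> 'cV[R]_4) (t : R) (u v : 'cV[R]_4) : R :=
  (1 - epsilon Amax x t) * mink u v.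

(* F p is the matrix of covariant components F_{mu nu} at p; raise_index gives
   F^mu_nu = eta^{mu rho} F_{rho nu}, with eta^{mu rho} the inverse metric. *)
Definition raise_index (F : 'cV[R]_4 -> 'M[R]_4) (p : 'cV[R]_4) : 'M[R]_4 :=
  invmx eta *m F p.

Definition lorentz_force (e : R) (F : 'cV[R]_4 -> 'M[R]_4)
    (x : R -> 'cV[R]_4) (t : R) : 'cV[R]_4 :=
  e *: (raise_index F (x t) *m velocity x t).

Definition FL2 (e : R) (F : 'cV[R]_4 -> 'M[R]_4)
    (x : R -> 'cV[R]_4) (t : R) : R :=
  e ^+ 2 * mink (raise_index F (x t) *m velocity x t)
                (raise_index F (x t) *m velocity x t).

(* The force is orthogonal to the timelike velocity, hence FL2 >= 0 and the
   square root is a genuine magnitude. *)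
Definition FL (e : R) (F : 'cV[R]_4 -> 'M[R]_4)
    (x : R -> 'cV[R]_4) (t : R) : R :=
  Num.sqrt (FL2 e F x t).

End Minkowski.

(* Main.v *)
(** Contracting a skew form twice with the velocity [v] gives zero, so the
    Lorentz force is orthogonal to [v].  Squaring the equation of motion thus
    gives [m^2 a^2 = FL^2 + (2/3 e^2 a^2)^2 eta(v, v)], and the
    parameterization makes [v] timelike; hence [0 <= m^2 a^2 <= FL^2]. *)

Require Import Defs.
From HB Require Import structures.
From mathcomp Require Import all_boot all_order all_algebra.
From mathcomp Require Import all_classical all_reals all_analysis.
From mathcomp Require Import lra.

Import Order.TTheory GRing.Theory Num.Theory.
Import numFieldNormedType.Exports.

Local Open Scope classical_set_scope.
Local Open Scope ring_scope.

(** The matrix form lets symmetry and bilinearity of [mink] follow from matrix algebra. *)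
Lemma minkE (R : realType) (u v : 'cV[R]_4) :
  mink u v = (u^T *m Defs.eta R *m v) ord0 ord0.
Proof.
rewrite mxE /mink exchange_big; apply: eq_bigr => j _ /=.
rewrite mxE mulr_suml; apply: eq_bigr => i _.
by rewrite [u^T _ _]mxE (mulrC (u i _)).
Qed.

Lemma eta_sym (R : realType) : (Defs.eta R)^T = Defs.eta R.
Proof. exact: tr_diag_mx. Qed.

(** [invmx] is a true inverse only on [unitmx]; this licenses cancelling [eta] against the raised
    index. *)
Lemma eta_unit (R : realType) : Defs.eta R \in unitmx.
Proof.
rewrite unitmxE det_diag unitfE; apply/prodf_neq0 => i _.
by rewrite mxE; case: ifP => _; rewrite ?oppr_eq0 oner_eq0.
Qed.

Lemma minkC (R : realType) (u v : 'cV[R]_4) : mink u v = mink v u.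
Proof.
rewrite !minkE.
have -> : v^T *m Defs.eta R *m u = (u^T *m Defs.eta R *m v)^T.
  by rewrite !trmx_mul trmxK eta_sym mulmxA.
by rewrite [RHS]mxE.
Qed.

Lemma minkDr (R : realType) (u v w : 'cV[R]_4) :
  mink u (v + w) = mink u v + mink u w.
Proof. by rewrite !minkE mulmxDr mxE. Qed.

Lemma minkZr (R : realType) (c : R) (u v : 'cV[R]_4) :
  mink u (c *: v) = c * mink u v.
Proof. by rewrite !minkE -scalemxAr mxE. Qed.

Lemma minkDl (R : realType) (u v w : 'cV[R]_4) :
  mink (u + v) w = mink u w + mink v w.
Proof. by rewrite minkC minkDr !(minkC _ w). Qed.

Lemma minkZl (R : realType) (c : R) (u v : 'cV[R]_4) :
  mink (c *: u) v = c * mink u v.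
Proof. by rewrite minkC minkZr minkC. Qed.

(** The product is a 1x1 matrix: transposition fixes its entry, whereas skewness of [A] negates
    it. *)
Lemma skew_quadratic_form0 (R : realType) (n : nat)
    (A : 'M[R]_n) (u : 'cV[R]_n) :
  A^T = - A -> (u^T *m A *m u) ord0 ord0 = 0.
Proof.
move=> A_skew; set B := u^T *m A *m u.
have : B^T = - B by rewrite /B !trmx_mul trmxK A_skew mulNmx mulmxN mulmxA.
by move/matrixP/(_ ord0 ord0); rewrite !mxE => ?; lra.
Qed.

Lemma lorentz_force_orthogonal (R : realType) (e : R)
    (F : 'cV[R]_4 -> 'M[R]_4) (x : R -> 'cV[R]_4) (t : R) :
  (F (x t))^T = - F (x t) -> mink (velocity x t) (lorentz_force e F x t) = 0.
Proof.
move=> F_skew; rewrite minkZr minkE /raise_index -!mulmxA.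
(* The [eta] of the scalar product lowers the index that [raise_index] raised, which leaves the form
   [F] itself evaluated twice on the velocity. *)
by rewrite mulKVmx ?eta_unit// mulmxA skew_quadratic_form0 ?mulr0.
Qed.

Lemma FL2E (R : realType) (e : R) (F : 'cV[R]_4 -> 'M[R]_4)
    (x : R -> 'cV[R]_4) (t : R) :
  FL2 e F x t = mink (lorentz_force e F x t) (lorentz_force e F x t).
Proof. by rewrite minkZl minkZr mulrA -expr2. Qed.

(** The acceleration bound makes the conformal factor [1 - epsilon] positive, so [gmax] and [mink]
    give the velocity the same causal character. *)
Lemma velocity_timelike (R : realType) (Amax : R) (x : R -> 'cV[R]_4) (t : R) :
  0 < Amax -> accel2 x t < Amax ^+ 2 ->
  gmax Amax x t (velocity x t) (velocity x t) = - 1 ->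
  mink (velocity x t) (velocity x t) < 0.
Proof.
move=> Amax_gt0 a_lt; rewrite /gmax => unit_v.
have eps_lt1 : 0 < 1 - epsilon Amax x t.
  by rewrite subr_gt0 ltr_pdivrMr ?mul1r// exprn_gt0.
by rewrite -(pmulr_rlt0 _ eps_lt1) unit_v ltrN10.
Qed.

(** The radiation coefficient is an arbitrary [k], since it enters only through its square. *)
Lemma accel2_le_FL2 (R : realType) (m e k : R)
    (F : 'cV[R]_4 -> 'M[R]_4) (x : R -> 'cV[R]_4) (t : R) :
  (F (x t))^T = - F (x t) ->
  mink (velocity x t) (velocity x t) < 0 ->
  m *: acceleration x t = lorentz_force e F x t - k *: velocity x t ->
  m ^+ 2 * accel2 x t <= FL2 e F x t.
Proof.
move=> /(lorentz_force_orthogonal _ e F) L_orth v_lt0 eom.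
have -> : m ^+ 2 * accel2 x t
    = mink (m *: acceleration x t) (m *: acceleration x t).
  by rewrite minkZl minkZr mulrA -expr2.
rewrite FL2E eom -scaleNr.
move: (lorentz_force e F x t) (velocity x t) L_orth v_lt0 {eom}.
move=> L v L_orth v_lt0; rewrite !(minkDl, minkDr, minkZl, minkZr).
rewrite (minkC _ L v) L_orth.
(* The cross terms have vanished; what remains is that [k ^+ 2 * mink v v] is nonpositive. *)
have := sqr_ge0 k; nra.
Qed.

Theorem theorem6p4 (R : realType) (m e Amax T0 : R)
  (F : 'cV[R]_4 -> 'M[R]_4) (x : R -> 'cV[R]_4)
  (m_gt0 : 0 < m) (e_neq0 : e != 0) (Amax_gt0 : 0 < Amax)
  (F_smooth : smooth_on setT F)
  (F_antisym : forall p : 'cV[R]_4, (F p)^T = - F p)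
  (x_smooth : smooth_on [set t : R | T0 < t] x)
  (accel_bound : forall t : R, T0 < t -> 0 <= accel2 x t < Amax ^+ 2)
  (proper_time : forall t : R, T0 < t ->
    gmax Amax x t (velocity x t) (velocity x t) = - 1)
  (motion : forall t : R, T0 < t ->
    m *: acceleration x t =
      lorentz_force e F x t
      - (2 / 3 * e ^+ 2 * mink (acceleration x t) (acceleration x t))
        *: velocity x t) :
  FL e F x t @[t --> +oo] --> (0 : R) ->
  accel2 x t @[t --> +oo] --> (0 : R).
Proof.
move=> FL_to0.
apply: (@squeeze_cvgr _ _ _ _ (fun=> 0) (fun t => m ^- 2 * FL e F x t ^+ 2)).
- near=> t.
  have T0_lt_t : T0 < t by near: t; apply: nbhs_pinfty_gt; exact: num_real.
  have /andP[a_ge0 a_lt] := accel_bound t T0_lt_t.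
  have v_lt0 := velocity_timelike _ _ _ _ Amax_gt0 a_lt (proper_time t T0_lt_t).
  have a_le := accel2_le_FL2 _ _ _ _ _ _ _
    (F_antisym (x t)) v_lt0 (motion t T0_lt_t).
  (* [Num.sqrt] is 0 on negative reals, so undoing it requires [FL2] to be nonnegative; this follows
     from [a_le] and [a_ge0]. *)
  rewrite a_ge0 /= sqr_sqrtr ?ler_pdivlMl ?exprn_gt0//.
  by apply: le_trans a_le; rewrite mulr_ge0 ?sqr_ge0.
- exact: cvg_cst.
(* The limit 0 is rewritten as [m ^- 2 * (0 * 0)] to match the product rule for limits. *)
- rewrite -(mulr0 (m ^- 2)) -[X in _ * X](mulr0 (0 : R)).
  by apply: cvgM; [exact: cvg_cst|exact: cvgM].
Unshelve. all: by end_near.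
Qed.
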